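(* Let $M$ be a semigroup, let $A$ be a finite set, and let $X \subset A^M$ be an $M$-subshift. Every finitely generated subgroup $G$ of $\mathrm{Aut}(X,M)$ that is pointwise periodic is finite.
   Context: $A^M$ is the set of maps $x : M \to A$, $h \mapsto x_h$, with the product topology ($A$ discrete). $M$ acts on $A^M$ from the right by the shift: $(x\cdot m)_h = x_{mh}$ for $m,h\in M$. An $M$-subshift is a closed subset $X \subset A^M$ such that $x \cdot m \in X$ for all $x\in X$, $m \in M$. $\mathrm{Aut}(X,M)$ denotes the group (under composition) of all homeomorphisms $f : X \to X$ such that $f(x\cdot m) = f(x)\cdot m$ for all $x \in X$, $m \in M$. A subgroup $G$ of $\mathrm{Aut}(X,M)$ is pointwise periodic if for every $x \in X$ the orbit $\{g(x) : g \in G\}$ is finite (equivalently, the stabilizer of every $x \in X$ has finite index in $G$).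
   Formalization: ''Semigroup'' is taken to mean semigroup with identity (monoid): without an identity the claim fails, e.g. for a countable null semigroup (mh = 0) acting on the configurations over {0,1} with x_0 = 0 and at most one 1. *)

(* Defs.v *)
From HB Require Import structures.
From mathcomp Require Import all_boot.
From mathcomp Require Import boolp classical_sets functions cardinality.
From mathcomp Require Import topology.

Set Implicit Arguments.
Unset Strict Implicit.
Unset Printing Implicit Defensive.

Local Open Scope classical_set_scope.
Local Open Scope group_scope.

Definition homeomorphism (T U : topologicalType) (f : T -> U) : Prop :=
  continuous f /\ exists g : U -> T, [/\ continuous g, cancel f g & cancel g f].

Section Subgroups.
Variable gT : groupType.

Definition is_subgroup (G : set gT) : Prop :=
  [/\ G 1, (forall f g, G f -> G g -> G (f * g)) & (forall f, G f -> G f^-1)].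

Definition subgroup_generated (S : set gT) : set gT := smallest is_subgroup S.

Definition finitely_generated (G : set gT) : Prop :=
  exists2 S : set gT, finite_set S & G = subgroup_generated S.

End Subgroups.

(* The configuration space, the shift and Aut make sense over any semigroup M.
   An identity of M is what makes an equivariant f determined by its local rule
   x |-> (f x)_1, since (f x)_h = (f x . h)_1 = (f (x . h))_1.  Without it, an
   infinite finitely generated group of automorphisms can be pointwise periodic:
   if mh = 0 for all m, h, then x . m is the constant configuration x_0, and
   equivariance constrains f very little. *)
Section Shift.
Variables (A : finType) (M : semigroupType).

Definition full_shift : Type := {ptws M -> discrete_topology A}.
HB.instance Definition _ :=
  Topological.copy full_shift {ptws M -> discrete_topology A}.

Definition shift (x : full_shift) (m : M) : full_shift := fun h => x (m * h).

Record subshift := Subshift {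
  subshift_set :> set full_shift;
  subshift_closed : closed subshift_set;
  subshift_shift : forall x m, subshift_set x -> subshift_set (shift x m)
}.

End Shift.

Section Aut.
Variables (A : finType) (M : semigroupType) (X : subshift A M).

(* The right action of M on X: \val (act x m) = shift (\val x) m. *)
Definition act (x : X) (m : M) : X :=
  exist _ (shift (\val x) m)
    (mem_set (subshift_shift m (set_mem (valP x)))).

Record Aut := MkAut {
  aut_fun :> X -> X;
  aut_homeo : homeomorphism aut_fun;
  aut_act : forall (x : X) (m : M), aut_fun (act x m) = act (aut_fun x) m
}.

HB.instance Definition _ := gen_eqMixin Aut.
HB.instance Definition _ := gen_choiceMixin Aut.

Lemma aut_eq (f g : Aut) : f =1 g -> f = g.
Proof.
case: f g => [f hf cf] [g hg cg] /= /funext efg.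
by case: _ / efg in hg cg *; congr MkAut; exact: Prop_irrelevance.
Qed.

Definition aut1 : Aut.
Proof.
apply: (@MkAut id) => //; split; first exact: (fun x => cvg_id).
by exists id; split=> //; exact: (fun x => cvg_id).
Defined.

(* The product of Aut is composition: (f * g) x = f (g x). *)
Definition autM (f g : Aut) : Aut.
Proof.
apply: (@MkAut (f \o g)) => [|x m]; last by rewrite /= !aut_act.
case: (aut_homeo f) (aut_homeo g) => [cf [f' [cf' fK f'K]]] [cg [g' [cg' gK g'K]]].
split; first by move=> x; apply: continuous_comp; [exact: cg|exact: cf].
exists (g' \o f'); split; [|exact: can_comp|exact: can_comp].
by move=> x; apply: continuous_comp; [exact: cf'|exact: cg'].
Defined.

Definition aut_inv (f : Aut) : X -> X := projT1 (cid (aut_homeo f).2).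

Lemma aut_invP (f : Aut) :
  [/\ continuous (aut_inv f), cancel f (aut_inv f) & cancel (aut_inv f) f].
Proof. exact: projT2 (cid (aut_homeo f).2). Qed.

Definition autV (f : Aut) : Aut.
Proof.
apply: (@MkAut (aut_inv f)) => [|x m]; have [cg fK gK] := aut_invP f.
  by split=> //; exists f; split=> //; exact: (aut_homeo f).1.
by rewrite -[in LHS](gK x) -aut_act fK.
Defined.

Lemma autMA : associative autM. Proof. by move=> f g h; exact: aut_eq. Qed.
Lemma aut1M : left_id aut1 autM. Proof. by move=> f; exact: aut_eq. Qed.
Lemma autM1 : right_id aut1 autM. Proof. by move=> f; exact: aut_eq. Qed.
Lemma autVM : left_inverse aut1 autV autM.
Proof. by move=> f; apply: aut_eq => x; have [_ fK _] := aut_invP f; exact: fK. Qed.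
Lemma autMV : right_inverse aut1 autV autM.
Proof. by move=> f; apply: aut_eq => x; have [_ _ gK] := aut_invP f; exact: gK. Qed.

HB.instance Definition _ := isGroup.Build Aut autMA aut1M autM1 autVM autMV.

Definition orbit (G : set Aut) (x : X) : set X := [set g x | g in G].

Definition pointwise_periodic (G : set Aut) : Prop :=
  forall x : X, finite_set (orbit G x).

End Aut.

(* Main.v *)
Require Import Defs.
From mathcomp Require Import all_boot.
From mathcomp Require Import boolp classical_sets functions cardinality.
From mathcomp Require Import topology.

Set Implicit Arguments.
Unset Strict Implicit.
Unset Printing Implicit Defensive.

(** Write x_1 for the value of a configuration x at the identity of M.  An
    automorphism g is determined by the map x |-> (g x)_1, because
    (g x)_m = ((g x).m)_1 = (g (x.m))_1.  So it is enough to find finitely many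
    elements b of G such that the values (b x)_1 determine (g x)_1 for every g
    in G: each g is then given by a rule from finitely many finite patterns to
    the finite alphabet, and there are only finitely many such rules.

    These elements b form a ball B_n of G for the word length.  That some n
    works is a fact about compact spaces ([finite_window]), applied to the
    diagonal action of G on pairs (x, y), whose orbits are finite as well, and
    to the clopen set D of the pairs with x_1 = y_1: if a finitely generated
    group acts continuously on a compact space with finite orbits and D is
    clopen, then for some n an orbit lies in D as soon as the part B_n p of it
    does, for any p.

    It suffices that, at every point, staying in D on B_n forces staying in D on
    B_(n+1), for this repeats along words.  If no n had this property, there
    would be for every n a point p_n with B_n p_n inside D and a word s_n b_n of
    length n + 1, s_n being the letter that acts last, that takes p_n out of D.
    Recentre at the place of the exit: q_n = b_n p_n.  Along the way back from
    q_n to p_n the orbit stays in D on larger and larger balls, and yet one more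
    letter, applied to q_n, leaves D.  For fixed i, the property that B_i u lies in
    D for some u in B_i q is closed, as B_i is finite, and it holds at q_n when
    n >= i; so it passes to a cluster point q of the q_n, for all i at once.
    For i large, B_i u is the whole orbit of q, which is therefore inside D.
    But being taken out of D by some letter is a closed property too, so q has
    it: a contradiction. *)

Local Open Scope classical_set_scope.
Local Open Scope group_scope.

(** * Word balls in a group *)

Section WordBalls.
Variables (gT : groupType) (T : set gT).

Fixpoint word_ball (n : nat) : set gT :=
  if n is n'.+1 then [set s * b | s in T & b in word_ball n'] else [set 1].

Lemma word_ball1 : word_ball 1 = T.
Proof.
apply/seteqP; split=> [_ [s Ts [_ -> <-]]|s Ts] /=; first by rewrite mulg1.
by exists s => //; exists 1; rewrite ?mulg1.
Qed.

Lemma word_ballM i j f g :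
  word_ball i f -> word_ball j g -> word_ball (i + j) (f * g).
Proof.
elim: i f => [|i IHi] f /=; first by move=> ->; rewrite mul1g add0n.
move=> [s Ts [b Bb <-]] Bg; exists s => //.
by exists (b * g); [exact: IHi|rewrite mulgA].
Qed.

Lemma word_ball_split i j h : word_ball (i + j) h ->
  exists f g, [/\ word_ball i f, word_ball j g & h = f * g].
Proof.
elim: i h => [|i IHi] h; first by exists 1, h; rewrite mul1g.
move=> [s Ts [b /IHi[f [g [Bf Bg ->]]] <-]].
by exists (s * f), g; split=> //; [exists s => //; exists f|rewrite mulgA].
Qed.

Lemma finite_word_ball n : finite_set T -> finite_set (word_ball n).
Proof.
move=> finT; elim: n => [|n IHn] /=; first exact: finite_set1.
exact: finite_image2.
Qed.

Lemma word_ballV n f : (forall s, T s -> T s^-1) ->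
  word_ball n f -> word_ball n f^-1.
Proof.
move=> TV; elim: n f => [|n IHn] f; first by move=> ->; rewrite /= invg1.
move=> [s Ts [b /IHn Bb <-]]; rewrite invgM -addn1.
by apply: word_ballM => //; rewrite word_ball1; exact: TV.
Qed.

Hypothesis T1 : T 1.

Lemma word_ball_id n : word_ball n 1.
Proof. by elim: n => //= n IHn; exists 1 => //; exists 1; rewrite ?mulg1. Qed.

Lemma word_ball_le i j : (i <= j)%N -> word_ball i `<=` word_ball j.
Proof.
move=> /subnKC<- f Bf; rewrite -[f]mulg1.
by apply: word_ballM => //; exact: word_ball_id.
Qed.

End WordBalls.

(** The letters include the identity, so that balls grow with the radius, and
    the inverses, so that balls are symmetric. *)
Definition letters (gT : groupType) (S : set gT) : set gT :=
  [set s | [\/ s = 1, S s | S s^-1]].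

Lemma letters1 (gT : groupType) (S : set gT) : letters S 1.
Proof. by constructor 1. Qed.

Lemma lettersV (gT : groupType) (S : set gT) s : letters S s -> letters S s^-1.
Proof.
case=> [->|Ss|Ss]; first by rewrite invg1; constructor 1.
- by constructor 3; rewrite invgK.
- by constructor 2.
Qed.

Lemma finite_letters (gT : groupType) (S : set gT) :
  finite_set S -> finite_set (letters S).
Proof.
move=> finS.
apply: (@sub_finite_set _ _ ([set 1] `|` S `|` [set s^-1 | s in S])); last first.
  by rewrite !finite_setU; do !split; [exact: finite_set1|done|exact: finite_image].
move=> s [->|Ss|Ss]; [by left; left|by left; right|right].
by exists s^-1; rewrite ?invgK.
Qed.

Lemma subgroup_generatedE (gT : groupType) (S : set gT) :
  subgroup_generated S = \bigcup_n word_ball (letters S) n.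
Proof.
apply/seteqP; split=> [f|f [n _]].
  apply; split; last by move=> s Ss; exists 1%N; rewrite ?word_ball1 //; constructor 2.
  split=> [|g h [i _ Bg] [j _ Bh]|g [i _ Bg]].
  - by exists 0%N.
  - by exists (i + j)%N => //; exact: word_ballM.
  - by exists i => //; apply: word_ballV Bg => s; exact: lettersV.
move=> + H [[H1 HM HV] SH]; elim: n f => [|n IHn] f; first by move=> ->.
move=> [s + [b /IHn Hb <-]]; case=> [->|/SH Hs|/SH Hs]; apply: HM => //.
by rewrite -[s]invgK; exact: HV.
Qed.

(** * Finite orbits and clopen sets *)

Lemma finite_set_bounded (U : choiceType) (A : set U) (F : nat -> set U) :
    finite_set A -> (forall i j, (i <= j)%N -> F i `<=` F j) ->
    A `<=` \bigcup_n F n ->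
  exists n, A `<=` F n.
Proof.
move=> /finite_seqP[s ->] Fle; elim: s => [_|x s IHs AF]; first by exists 0 => x.
have [|n sn] := IHs; first by move=> y sy; apply: AF => /=; rewrite inE sy orbT.
have [|m _ xm] := AF x; first by rewrite /= inE eqxx.
exists (maxn m n) => y /=; rewrite inE => /predU1P[->|sy].
  by apply: Fle xm; exact: leq_maxl.
by apply: Fle (sn y sy); exact: leq_maxr.
Qed.

Section FiniteWindow.
Variables (gT : groupType) (T : set gT) (P : topologicalType).
Variables (a : gT -> P -> P) (D : set P).
Hypotheses (T1 : T 1) (TV : forall s, T s -> T s^-1) (finT : finite_set T).
Hypotheses (aM : forall f g p, a (f * g) p = a f (a g p)).
Hypotheses (acont : forall g, continuous (a g)) (cptP : compact [set: P]).
Hypothesis a_finite :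
  forall p, finite_set [set a g p | g in \bigcup_n word_ball T n].
Hypothesis clopenD : clopen D.

Let B := word_ball T.

Definition inside_radius n : set P := [set p | forall g, B n g -> D (a g p)].

Lemma closed_inside_radius n : closed (inside_radius n).
Proof.
have -> : inside_radius n = \bigcap_(g in B n) (a g @^-1` D) by [].
apply: closed_bigI => g _; move/continuous_closedP: (@acont g); apply.
exact: clopenD.2.
Qed.

(** Balls grow one letter at a time, so if radius n + 1 comes for free at every
    point, then the property moves along each letter, hence along each word. *)
Lemma inside_radius_stable n : inside_radius n `<=` inside_radius n.+1 ->
  forall m p, inside_radius n p -> inside_radius m p.
Proof.
move=> Dn; elim=> [|m IHm] p Dp g.
  by move=> ->; apply: Dp; exact: word_ball_id.
rewrite -[m.+1]addn1 /B => /word_ball_split[f [s [Bf Bs ->]]].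
rewrite aM; apply: IHm => // h Bh; rewrite -aM; apply: (Dn p Dp).
by rewrite -addn1; exact: word_ballM.
Qed.

(** The orbit lies in a ball B_k q because it is finite.  The radius k + k then
    serves for every other centre too: go back to q, then to the target. *)
Lemma finite_orbit_radius q : exists n, forall i j g h, B i g -> B j h ->
  exists2 f, B n f & a h q = a f (a g q).
Proof.
have [||k Bk] :=
  @finite_set_bounded _ _ (fun n => [set a g q | g in B n]) (a_finite q).
- by move=> i j ij _ [g Bg <-]; exists g => //; exact: word_ball_le Bg.
- by move=> _ [g [i _ Bg] <-]; exists i => //; exists g.
exists (k + k)%N => i j g h Bg Bh.
have [|g' Bg' gq] := Bk (a g q); first by exists g => //; exists i.
have [|h' Bh' hq] := Bk (a h q); first by exists h => //; exists j.
exists (h' * g'^-1); first by apply: word_ballM => //; exact: word_ballV.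
by rewrite -gq -aM mulgVK hq.
Qed.

(** The compactness argument: n is a radius at which the sets [inside_radius]
    stop decreasing.  If they never did, the points q n below, just before the
    exit from D, would have a cluster point with an infinite orbit. *)
Lemma finite_window : exists n, forall p,
  (forall g, B n g -> D (a g p)) -> forall m g, B m g -> D (a g p).
Proof.
suff [n Dn] : exists n, inside_radius n `<=` inside_radius n.+1.
  by exists n => p Dp m; exact: (inside_radius_stable Dn).
apply: contrapT => /forallNP noDn.
have /choice[q qP] : forall n, exists q,
    (exists2 s, T s & ~ D (a s q)) /\
    (forall i, (i <= n)%N -> exists2 w, B i w & inside_radius i (a w^-1 q)).
  move=> n; have /existsNP[p /not_implyP[Dp]] := noDn n.
  move=> /existsNP[_ /not_implyP[[s Ts [b Bb <-]]]]; rewrite aM => nD.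
  exists (a b p); split; first by exists s.
  move=> i le_in; move: Bb; rewrite -{1}(subnKC le_in).
  move=> /word_ball_split[w [v [Bw Bv ->]]]; exists w => // f Bf.
  rewrite -!aM !mulgA mulgVK; apply: Dp.
  by rewrite -(subnKC le_in); exact: word_ballM.
have [r [_ clr]] : [set: P] `&` cluster (q @ \oo) !=set0.
  by apply: cptP; exact: filterT.
have cluster_in (E : set P) N :
    closed E -> (forall n, (N <= n)%N -> E (q n)) -> E r.
  move=> /closure_id clE Eq; rewrite clE; move: clr; rewrite clusterE; apply.
  by exists N => // n; exact: Eq.
(* The cluster point is one letter away from the outside of D. *)
have [s Ts nDs] : exists2 s, T s & ~ D (a s r).
  apply: (cluster_in (\bigcup_(s in T) (a s @^-1` ~` D)) 0%N).
    apply: closed_bigcup => // s _; move/continuous_closedP: (@acont s); apply.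
    exact: open_closedC clopenD.1.
  by move=> n _; have [[s Ts nDs] _] := qP n; exists s.
(* But at most i letters away from r is a point whose ball of radius i stays in
   D, and for a suitable i this ball is the whole orbit of r. *)
have [i iP] := finite_orbit_radius r.
have [w Bw Dw] : exists2 w, B i w & inside_radius i (a w^-1 r).
  apply: (cluster_in (\bigcup_(w in B i) (a w^-1 @^-1` inside_radius i)) i).
    apply: closed_bigcup; first exact: finite_word_ball.
    move=> w _; move/continuous_closedP: (@acont w^-1); apply.
    exact: closed_inside_radius.
  by move=> n /(qP n).2.
have Bs : B 1%N s by rewrite /B word_ball1.
have [f Bf fE] := iP _ _ _ _ (word_ballV TV Bw) Bs.
by apply: nDs; rewrite fE; exact: Dw.
Qed.

End FiniteWindow.

(** * Automorphisms and their local rules *)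

Section LocalRules.
Variables (M : monoidType) (A : finType) (X : subshift A M).

Lemma compact_full_shift : compact [set: full_shift A M].
Proof.
have -> : [set: full_shift A M] = [set f | forall m : M, setT (f m)].
  by apply/seteqP; split.
apply: (@tychonoff M (fun=> discrete_topology A) (fun=> setT)) => _.
exact/finite_compact/finite_finset.
Qed.

Lemma compact_subshift : compact [set: X].
Proof.
move=> F FF _.
have cptX : compact (X : set (full_shift A M)).
  apply: subclosed_compact compact_full_shift (@subsetT _ _).
  exact: subshift_closed.
have [|x [Xx clx]] := cptX (set_val @ F) _.
  by apply: nearW => x; exact: set_valP.
exists (exist _ x (mem_set Xx)); split=> // U V FU.
move=> [_ [[W oW <-] Wx WV]].
have FU' : F (set_val @^-1` (set_val @` U)).
  by apply: filterS FU => y Uy; exists y.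
have [_ [[y Uy <-] Wy]] := clx _ W FU' (open_nbhs_nbhs (conj oW Wx)).
by exists y; split=> //; exact: WV.
Qed.

Definition symbol1 (x : X) : A := \val x 1.

Lemma symbol1_continuous : continuous (symbol1 : X -> discrete_topology A).
Proof.
move=> x; apply: (@continuous_comp _ (full_shift A M) _ set_val (fun y => y 1)).
  exact: initial_continuous.
exact: (@proj_continuous M (fun=> discrete_topology A) 1).
Qed.

Lemma clopen_same_symbol1 : clopen [set p : X * X | symbol1 p.1 = symbol1 p.2].
Proof.
have eqD : [set p : X * X | symbol1 p.1 = symbol1 p.2] =
    \bigcup_(c : A) (symbol1 @^-1` [set c] `*` symbol1 @^-1` [set c]).
  apply/seteqP; split=> [p /= e|p [c _ [/= -> ->]]//].
  by exists (symbol1 p.1).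
have fst_cont : continuous (symbol1 \o fst : X * X -> discrete_topology A).
  by move=> p; apply: continuous_comp; [exact: cvg_fst|exact: symbol1_continuous].
have snd_cont : continuous (symbol1 \o snd : X * X -> discrete_topology A).
  by move=> p; apply: continuous_comp; [exact: cvg_snd|exact: symbol1_continuous].
rewrite eqD; split; last (apply: closed_bigcup; first exact: finite_finset);
  first apply: bigcup_open; move=> c _.
- apply: openI.
    by move/continuousP: fst_cont; apply; exact: discrete_open.
  by move/continuousP: snd_cont; apply; exact: discrete_open.
- apply: closedI.
    by move/continuous_closedP: fst_cont; apply; exact: discrete_closed.
  by move/continuous_closedP: snd_cont; apply; exact: discrete_closed.
Qed.

(** This is where the identity of M enters: an equivariant map is known once
    it is known at one coordinate. *)
Lemma aut_val (g : Aut X) x m : \val (g x) m = symbol1 (g (act x m)).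
Proof. by rewrite aut_act /symbol1 /= /shift mulg1. Qed.

Lemma aut_symbol1_inj (g h : Aut X) :
  (forall x, symbol1 (g x) = symbol1 (h x)) -> g = h.
Proof.
move=> gh; apply: aut_eq => x; apply: val_inj; apply: funext => m.
by rewrite !aut_val.
Qed.

Definition pair_act (g : Aut X) (p : X * X) : X * X := (g p.1, g p.2).

Lemma pair_act_continuous g : continuous (pair_act g).
Proof.
move=> p; have gcont := (aut_homeo g).1.
have g1 : (g \o fst) @ p --> g p.1.
  by apply: continuous_comp; [exact: cvg_fst|exact: gcont].
have g2 : (g \o snd) @ p --> g p.2.
  by apply: continuous_comp; [exact: cvg_snd|exact: gcont].
exact: cvg_pair g1 g2.
Qed.

Lemma finite_pair_orbit (G : set (Aut X)) p :
  pointwise_periodic G -> finite_set [set pair_act g p | g in G].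
Proof.
move=> perG; apply: (@sub_finite_set _ _ (Defs.orbit G p.1 `*` Defs.orbit G p.2)).
  by move=> _ [g Gg <-]; split; exists g.
by apply: finite_setX; exact: perG.
Qed.

Definition pattern (s : seq (Aut X)) (x : X) : (size s).-tuple A :=
  [tuple symbol1 (nth 1 s i x) | i < size s].

(** The rule of g is a relation between patterns and symbols: it is defined for
    any s, and is the graph of a partial function exactly when the symbols
    (b x)_1, with b in s, determine (g x)_1. *)
Definition local_rule (s : seq (Aut X)) (g : Aut X) :
    {set (size s).-tuple A * A} :=
  [set p | `[< exists2 x, pattern s x = p.1 & symbol1 (g x) = p.2 >]]%SET.

Lemma eq_pattern (s : seq (Aut X)) x y : pattern s x = pattern s y ->
  forall b, b \in s -> symbol1 (b x) = symbol1 (b y).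
Proof.
move=> xy b sb; have i_lt : (index b s < size s)%N by rewrite index_mem.
have := congr1 (fun t => tnth t (Ordinal i_lt)) xy.
by rewrite !tnth_mktuple /= !nth_index.
Qed.

End LocalRules.

Theorem theorem1p3 (M : monoidType) (A : finType) (X : subshift A M)
    (G : set (Aut X)) :
  is_subgroup G -> finitely_generated G -> pointwise_periodic G ->
  finite_set G.
Proof.
move=> _ [S finS GE] perG.
have {}GE : G = \bigcup_n word_ball (letters S) n.
  by rewrite GE subgroup_generatedE.
(* A window for the pairs of configurations with the same symbol at 1: if x
   and y have the same pattern on a ball of G, they have the same pattern on
   the whole of G. *)
have [||||||||n nP] := @finite_window _ (letters S) (X * X)%type (@pair_act _ _ X)
  [set p | symbol1 p.1 = symbol1 p.2].
- exact: letters1.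
- by move=> s; exact: lettersV.
- exact: finite_letters.
- by [].
- exact: pair_act_continuous.
- by rewrite -setXTT; apply: compact_setX; exact: compact_subshift.
- by move=> p; rewrite -GE; exact: finite_pair_orbit.
- exact: clopen_same_symbol1.
have /finite_seqP[s sE] := finite_word_ball n (finite_letters finS).
(* g and h agree at x because a configuration y with the pattern of x links
   them: (g x)_1 = (h y)_1 by equality of the rules, and (h y)_1 = (h x)_1
   by the choice of n. *)
have rule_inj : {in G &, injective (local_rule s)}.
  move=> g h; rewrite !inE GE => -[i _ Bg] [j _ Bh] gh.
  apply: aut_symbol1_inj => x.
  have : (pattern s x, symbol1 (g x)) \in local_rule s g.
    by rewrite finset.inE; apply/asboolP; exists x.
  rewrite gh finset.inE => /asboolP[y /= pxy <-].
  apply: (nP (y, x) _ _ _ Bh) => b Bb /=.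
  by apply: (eq_pattern pxy); move: Bb; rewrite sE.
rewrite -(eq_finite_set (inj_card_eq rule_inj)).
exact: finite_finset.
Qed.
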